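(* Let $G=G_n(g,f)$ be a proper Riordan graph with $f'(0)=1$ and $f\not\equiv t \pmod 2$, whose binary $A$-sequence has the form $$(\tilde a_k)_{k\ge0}=(1,\underbrace{0,\ldots,0}_{\ell\text{ times}},1,\tilde a_{\ell+2},\ldots),\qquad \ell\ge 0,\ \tilde a_k\in\{0,1\},$$ where $\ell\ge0$ is the maximum number of consecutive zero terms starting from $\tilde a_1$. Let $i,j\in[n]$ with $i>j$, let $s\ge 0$ be the least nonnegative integer satisfying $s\ge\log_2\frac{i-j}{\ell+1}$, and let $m$ be an integer with $\frac{1-j}{2^s}\le m\le\frac{n-i}{2^s}$. Then the following induced subgraphs of $G$ are isomorphic: $$\left\langle\{j,j+1,\ldots,i\}\right\rangle\cong\left\langle\{j+m2^s,\,j+1+m2^s,\,\ldots,\,i+m2^s\}\right\rangle.$$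
   Context: $[t^k]u$ is the coefficient of $t^k$ in $u$ and $\equiv$ is congruence mod $2$. For $g,f\in\mathbb{Z}[[t]]$ (or $\mathbb{Z}_2[[t]]$) with $f(0)=0$, the Riordan graph $G_n(g,f)$ is the simple graph on $[n]=\{1,\dots,n\}$ in which, for $i>j\ge1$, $i$ and $j$ are adjacent iff $[t^{i-2}]\,g f^{\,j-1}\equiv 1$. It is proper if $g(0)\equiv f'(0)\equiv 1$. The binary $A$-sequence of a proper Riordan graph $G_n(g,f)$ is the unique $(0,1)$-sequence $(\tilde a_k)_{k\ge0}$ with $\tilde a_0=1$ whose generating function $A(t)=\sum_k\tilde a_kt^k$ satisfies $f\equiv tA(f)$. $\langle S\rangle$ is the subgraph of $G$ induced by $S$. *)

(* Defs.v *)
From HB Require Import structures.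
From mathcomp Require Import all_boot all_order all_algebra.
From mathcomp Require Import reals exp.
Set Implicit Arguments.
Unset Strict Implicit.
Unset Printing Implicit Defensive.
Import Order.TTheory GRing.Theory Num.Theory.
Local Open Scope ring_scope.

Section PowerSeries.
Variable R : comNzRingType.

(* A formal power series is its sequence of coefficients: [t^k]u is u k. *)
Definition fps := nat -> R.

Implicit Types u v : fps.

Definition fps_one : fps := fun n => (n == 0%N)%:R.
Definition fps_t : fps := fun n => (n == 1%N)%:R.
Definition fps_mul u v : fps := fun n => \sum_(k < n.+1) u k * v (n - k)%N.
Definition fps_pow u (k : nat) : fps := iter k (fps_mul u) fps_one.
Definition fps_deriv u : fps := fun n => u n.+1 *+ n.+1.

(* u(v(t)); meaningful only when v(0) = 0, in which case v^k contributes
   nothing to degree n for k > n. *)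
Definition fps_comp u v : fps :=
  fun n => \sum_(k < n.+1) u k * fps_pow v k n.

End PowerSeries.

(* Only residues mod 2 matter below, so a series over Z_2 is covered by its
   lift with coefficients in {0,1}. *)
Definition fps_eqmod2 (u v : fps int) : Prop :=
  forall k, (u k = v k %[mod 2])%Z.

Record sgraph := SGraph {
  vertex :> finType;
  adj : rel vertex;
  adj_sym : symmetric adj;
  adj_irrefl : irreflexive adj }.

Section Induced.
Variables (G : sgraph) (S : {set G}).

Definition induced_adj : rel {x : G | x \in S} :=
  fun x y => adj (val x) (val y).

Lemma induced_adj_sym : symmetric induced_adj.
Proof. by move=> x y; exact: adj_sym. Qed.

Lemma induced_adj_irrefl : irreflexive induced_adj.
Proof. by move=> x; exact: adj_irrefl. Qed.

Definition induced : sgraph := SGraph induced_adj_sym induced_adj_irrefl.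
End Induced.

Definition isomorphic (G H : sgraph) : Prop :=
  exists2 phi : G -> H, bijective phi
    & forall x y, adj (phi x) (phi y) = adj x y.

Section RiordanGraph.
Variables (n : nat) (g f : fps int).

(* The vertex set [n] = {1,...,n} is 'I_n, whose element v stands for the
   integer v + 1. *)
Definition label (v : 'I_n) : nat := v.+1.

(* Arguments are labels; the truncated subtractions are exact since they are
   evaluated only when i > j >= 1. *)
Definition riordan_edge (i j : nat) : bool :=
  (j < i)%N && (fps_mul g (fps_pow f (j - 1)) (i - 2)%N == 1 %[mod 2])%Z.

Definition riordan_adj : rel 'I_n := fun v w =>
  riordan_edge (label v) (label w) || riordan_edge (label w) (label v).

Lemma riordan_adj_sym : symmetric riordan_adj.
Proof. by move=> v w; rewrite /riordan_adj orbC. Qed.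

Lemma riordan_adj_irrefl : irreflexive riordan_adj.
Proof. by move=> v; rewrite /riordan_adj /riordan_edge ltnn. Qed.

Definition riordan_graph : sgraph := SGraph riordan_adj_sym riordan_adj_irrefl.

(* The vertices whose labels lie in {a, a+1, ..., b}. *)
Definition vertex_interval (a b : int) : {set riordan_graph} :=
  [set v : 'I_n | a <= (label v)%:Z <= b].

End RiordanGraph.

Definition proper_riordan (g f : fps int) : Prop :=
  (g 0%N = 1 %[mod 2])%Z /\ (fps_deriv f 0%N = 1 %[mod 2])%Z.

Definition binary_A_sequence (f a : fps int) : Prop :=
  [/\ forall k, a k = 0 \/ a k = 1,
      a 0%N = 1
    & fps_eqmod2 f (fps_mul (fps_t _) (fps_comp a f))].

Definition log2 (R : realType) (x : R) : R := ln x / ln 2.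

(* Main.v *)
Require Import Defs.
From mathcomp Require Import all_boot all_order all_algebra.
From mathcomp Require Import reals exp.
From mathcomp Require Import zify.
Import Order.TTheory GRing.Theory Num.Theory.
Local Open Scope ring_scope.

(** Modulo 2, adjacency of [i > j] is the entry of the Riordan array [(g, f)]
    in row [i - 2] and column [j - 1], and the theorem is a periodicity
    property of that array.  Feeding [A = 1 + O(t^(l+1))] into [f = t A(f)]
    gives [f = t + O(t^(l+2))] ([fps_eqmod2_t_of_A_sequence]).  Squaring is
    additive mod 2, so, with [P = 2^s], [f^P = t^P + O(t^((l+2)P))]
    ([expr_pow2_X_add]).  Multiplying column [j - 1] by [f^P] therefore shifts
    it down by [P] rows, up to an error starting [(l+2)P] rows below row
    [j - 1].  The error cannot be seen at entries with [i - j <= (l+1) P]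
    ([riordan_edge_shift_pow2]), and the choice of [s] says precisely that all
    pairs inside the window satisfy this bound.  Adding a nonnegative multiple
    of [P] to the labels is then the isomorphism; for [m < 0] it is the inverse
    of the shift starting from the lower window. *)

(** Truncation at degree [N] turns finitely many coefficients into a genuine
    polynomial, so that ring identities such as the Frobenius apply. *)
Definition trunc2 (N : nat) (u : fps int) : {poly 'F_2} :=
  \poly_(k < N) (u k)%:~R.

Lemma eqz_mod2E (x y : int) :
  (x == y %[mod 2])%Z = (x%:~R == y%:~R :> 'F_2).
Proof.
by rewrite eqz_mod_dvd (dvdz_pcharf (pchar_Fp (isT : prime 2))) rmorphB subr_eq0.
Qed.

Lemma coef_trunc2 {N k : nat} (u : fps int) :
  (k < N)%N -> (trunc2 N u)`_k = (u k)%:~R.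
Proof. by move=> ltkN; rewrite coef_poly ltkN. Qed.

(** Truncation is multiplicative in the degrees it retains, since the
    coefficient of degree [k] of a product only involves degrees up to [k]. *)
Lemma coef_fps_mul {N : nat} {u v : fps int} {p q : {poly 'F_2}} :
    (forall k, (k < N)%N -> p`_k = (u k)%:~R) ->
    (forall k, (k < N)%N -> q`_k = (v k)%:~R) ->
  forall k, (k < N)%N -> (p * q)`_k = (fps_mul u v k)%:~R.
Proof.
move=> up vq k ltkN; rewrite coefM /fps_mul rmorph_sum; apply: eq_bigr => h _.
rewrite rmorphM up; last exact: leq_ltn_trans (leq_ord h) ltkN.
by rewrite vq //; exact: leq_ltn_trans (leq_subr h k) ltkN.
Qed.

Lemma coef_fps_pow {N : nat} (u : fps int) (e k : nat) :
  (k < N)%N -> (trunc2 N u ^+ e)`_k = (fps_pow u e k)%:~R.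
Proof.
elim: e k => [|e IHe] k ltkN; first by rewrite expr0 coef1; case: k ltkN.
by rewrite exprS (coef_fps_mul (@coef_trunc2 N^~ u) IHe).
Qed.

(** Degree [k + 1] of [t A(f)] only involves [a_0, ..., a_k], and among these
    [a_0 = 1] alone survives when [k <= l]. *)
Lemma fps_eqmod2_t_of_A_sequence {f a : fps int} {l : nat} :
    binary_A_sequence f a ->
    (forall k : nat, (1 <= k <= l)%N -> a k = 0) ->
  forall k, (k < l.+2)%N -> (f k)%:~R = (k == 1%N)%:R :> 'F_2.
Proof.
case=> _ a0 fA a_zeros [|k] ltk.
  apply/eqP; move/eqP: (fA 0%N); rewrite eqz_mod2E => /eqP->.
  by rewrite /fps_mul big_ord_recl big_ord0 mul0r addr0.
apply/eqP; move/eqP: (fA k.+1); rewrite eqz_mod2E => /eqP->.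
rewrite /fps_mul big_ord_recl mul0r add0r big_ord_recl big1 => [|h _]; last first.
  by rewrite /fps_t /= mul0r.
rewrite /fps_t /= mul1r addr0 subn1 /= /fps_comp.
rewrite big_ord_recl big1 => [|h _]; last first.
  by rewrite a_zeros ?mul0r // lift0 /=; move: (ltn_ord h); lia.
by rewrite a0 mul1r addr0 /fps_pow /= /fps_one; case: k {ltk}.
Qed.

Lemma trunc2_A_sequence {f a : fps int} {l : nat} (N : nat) :
    binary_A_sequence f a ->
    (forall k : nat, (1 <= k <= l)%N -> a k = 0) -> (1 < N)%N ->
  exists w : {poly 'F_2}, trunc2 N f = 'X + w * 'X^(l.+2).
Proof.
move=> aP a_zeros ltN; exists (drop_poly l.+2 (trunc2 N f)).
rewrite -{1}(poly_take_drop l.+2 (trunc2 N f)); congr (_ + _).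
apply/polyP=> k; rewrite coef_take_poly coefX coef_poly.
case: ltnP => [ltkl | lelk]; last by case: k lelk => [|[]].
rewrite (fps_eqmod2_t_of_A_sequence aP a_zeros) //.
by case: (ltnP k N) => // leNk; case: k {ltkl} leNk => [|[]] //; lia.
Qed.

(** The iterated Frobenius endomorphism on [X + O(X^d)]. *)
Lemma expr_pow2_X_add (w : {poly 'F_2}) (d s : nat) :
  ('X + w * 'X^d) ^+ (2 ^ s) = 'X^(2 ^ s) + w ^+ (2 ^ s) * 'X^(d * 2 ^ s).
Proof.
rewrite exprDn_pchar ?exprMn -?exprM //.
by rewrite pnatX pnatE // pchar_poly pchar_Fp.
Qed.

Lemma riordan_edge_shift_pow2 {g f a : fps int} {l : nat} (s p q : nat) :
    binary_A_sequence f a ->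
    (forall k : nat, (1 <= k <= l)%N -> a k = 0) ->
    (0 < q)%N -> (p <= q + l.+1 * 2 ^ s)%N ->
  riordan_edge g f (p + 2 ^ s) (q + 2 ^ s) = riordan_edge g f p q.
Proof.
move=> aP a_zeros q0 lepq; rewrite /riordan_edge ltn_add2r.
case: ltnP => //= ltqp; rewrite !eqz_mod2E.
have P0 : (0 < 2 ^ s)%N by rewrite expn_gt0.
set P := (2 ^ s)%N in lepq P0 *.
(* Both entries being compared have degree below [p + P]. *)
have [w wE] := trunc2_A_sequence (p + P) aP a_zeros ltac:(lia).
have coefE e k : (k < p + P)%N ->
    (fps_mul g (fps_pow f e) k)%:~R = (trunc2 (p + P) g * trunc2 (p + P) f ^+ e)`_k.
  by move=> ltk; rewrite (coef_fps_mul (@coef_trunc2 _^~ g) (@coef_fps_pow _ f e)).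
rewrite !coefE; [|lia..].
set G := trunc2 _ g; set F := trunc2 _ f.
have -> : (q + P - 1 = q - 1 + P)%N by lia.
(* The factor X^(q-1) of F^(q-1) adds to the order of the error term. *)
have FX : F = (1 + w * 'X^(l.+1)) * 'X by rewrite mulrDl mul1r -mulrA -exprSr.
have -> : G * F ^+ (q - 1 + P) =
    G * F ^+ (q - 1) * 'X^P
    + G * (1 + w * 'X^(l.+1)) ^+ (q - 1) * w ^+ P * 'X^(q - 1 + l.+2 * P).
  rewrite exprD {2}/F wE expr_pow2_X_add mulrDr mulrDr mulrA; congr (_ + _).
  by rewrite FX exprMn exprD !mulrA -!(mulrAC _ _ 'X^(q - 1)).
rewrite coefD !coefMXn.
have -> : (p + P - 2 < P)%N = false by lia.
have -> : (p + P - 2 < q - 1 + l.+2 * P)%N by lia.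
by rewrite addr0; have -> : (p + P - 2 - P = p - 2)%N by lia.
Qed.

Lemma riordan_edge_shift {g f a : fps int} {l : nat} (s M p q : nat) :
    binary_A_sequence f a ->
    (forall k : nat, (1 <= k <= l)%N -> a k = 0) ->
    (0 < q)%N -> (p <= q + l.+1 * 2 ^ s)%N ->
  riordan_edge g f (p + M * 2 ^ s) (q + M * 2 ^ s) = riordan_edge g f p q.
Proof.
move=> aP a_zeros q0 lepq; elim: M => [|M IHM]; first by rewrite mul0n !addn0.
rewrite -IHM mulSn ![(2 ^ s + _)%N]addnC !addnA.
by apply: riordan_edge_shift_pow2 aP a_zeros _ _; lia.
Qed.

Lemma isomorphic_sym (G H : sgraph) : isomorphic G H -> isomorphic H G.
Proof.
case=> phi [psi phiK psiK] phi_adj; exists psi; first by exists phi.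
by move=> x y; rewrite -phi_adj !psiK.
Qed.

(** Only the restrictions of [h] and [h'] to [S] and [T] matter, so that a
    total map such as a shift, defined by default outside the window, will do. *)
Lemma isomorphic_induced (G : sgraph) (S T : {set G}) (h h' : G -> G) :
    (forall x, x \in S -> h x \in T) -> (forall y, y \in T -> h' y \in S) ->
    {in S, cancel h h'} -> {in T, cancel h' h} ->
    {in S &, forall x y, adj (h x) (h y) = adj x y} ->
  isomorphic (induced S) (induced T).
Proof.
move=> hS h'T hK h'K h_adj.
exists (fun x : induced S => exist (fun y => y \in T) (h (val x)) (hS _ (valP x))
         : induced T); last by move=> x y; apply: h_adj; exact: valP.
exists (fun y : induced T => exist (fun x => x \in S) (h' (val y)) (h'T _ (valP y))
         : induced S).
  by move=> x; apply: val_inj; apply: hK; exact: valP.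
by move=> y; apply: val_inj; apply: h'K; exact: valP.
Qed.

Lemma isomorphic_vertex_interval_shift (n j i d : nat) (g f : fps int) :
    (0 < j)%N -> (i + d <= n)%N ->
    (forall p q, (j <= q)%N -> (p <= i)%N ->
       riordan_edge g f (p + d) (q + d) = riordan_edge g f p q) ->
  isomorphic
    (induced (vertex_interval n g f j%:Z i%:Z))
    (induced (vertex_interval n g f (j + d)%:Z (i + d)%:Z)).
Proof.
case: n => [|n] j0 leidn edge_shift.
  (* [inord] below needs a nonempty vertex type; here both windows are empty. *)
  apply: (@isomorphic_induced _ _ _ id id) => //; by case.
apply: (@isomorphic_induced (riordan_graph n.+1 g f) _ _
         (fun x : 'I_n.+1 => inord (x + d)) (fun x : 'I_n.+1 => inord (x - d))).
- by move=> x; rewrite !inE /label => jxi; rewrite inordK; lia.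
- by move=> x; rewrite !inE /label => jxi; rewrite inordK; have := ltn_ord x; lia.
- move=> x; rewrite !inE /label => jxi; apply: val_inj.
  by rewrite /= !inordK; have := ltn_ord x; lia.
- move=> x; rewrite !inE /label => jxi; apply: val_inj.
  by rewrite /= !inordK; have := ltn_ord x; lia.
move=> x y; rewrite !inE /label => jxi jyi /=.
rewrite /riordan_adj /label !inordK; [|lia..].
by rewrite -!addSn !edge_shift //; lia.
Qed.

Lemma sub_le_of_log2 {R : realType} {i j l s : nat} :
    (j < i)%N -> log2 ((i%:R - j%:R) / l.+1%:R : R) <= s%:R ->
  (i <= j + l.+1 * 2 ^ s)%N.
Proof.
move=> ltji; rewrite -(natrB _ (ltnW ltji)) /log2 ler_pdivrMr; last first.
  by rewrite ln_gt0 // ltr1n.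
have ij0 : (0 : R) < (i - j)%:R / l.+1%:R.
  by rewrite divr_gt0 ?ltr0n // subn_gt0.
rewrite (mulr_natl (ln 2)) -lnXn ?ltr0n // ler_ln ?posrE ?exprn_gt0 ?ltr0n //.
by rewrite ler_pdivrMr ?ltr0n // -natrX -natrM ler_nat; lia.
Qed.

Theorem theorem3p11 (R : realType) (n : nat) (g f a : fps int)
    (l i j s : nat) (m : int)
    (f_const0 : f 0%N = 0)
    (gf_proper : proper_riordan g f)
    (f_deriv1 : fps_deriv f 0%N = 1)
    (f_neq_t : ~ fps_eqmod2 f (fps_t int))
    (aP : binary_A_sequence f a)
    (a_zeros : forall k : nat, (1 <= k <= l)%N -> a k = 0)
    (a_one : a l.+1 = 1)
    (i_in : (1 <= i <= n)%N)
    (j_in : (1 <= j <= n)%N)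
    (lt_ji : (j < i)%N)
    (s_ge : log2 ((i%:R - j%:R) / l.+1%:R : R) <= s%:R)
    (s_least : forall s' : nat,
       log2 ((i%:R - j%:R) / l.+1%:R : R) <= s'%:R -> (s <= s')%N)
    (m_bounds :
       (1 - j%:R) / 2 ^+ s <= (m%:~R : R) <= (n%:R - i%:R) / 2 ^+ s) :
  isomorphic
    (induced (vertex_interval n g f j%:Z i%:Z))
    (induced (vertex_interval n g f (j%:Z + m * 2 ^+ s) (i%:Z + m * 2 ^+ s))).
Proof.
have le_ij := sub_le_of_log2 lt_ji s_ge.
have P0 : (0 : R) < 2 ^+ s by rewrite exprn_gt0 ?ltr0n.
have PE : 2 ^+ s = (2 ^ s)%N%:Z by rewrite -natrX natz.
have [ge_j le_i] : 1 <= j%:Z + m * 2 ^+ s /\ i%:Z + m * 2 ^+ s <= n%:Z.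
  move/andP: m_bounds; rewrite ler_pdivrMr // ler_pdivlMr // lerBlDr lerBrDr.
  rewrite -!(ler_int R) !rmorphD !rmorphM !rmorphXn /=.
  by rewrite ![m%:~R * 2 ^+ s + _]addrC.
rewrite PE in ge_j le_i *.
case: m {m_bounds} ge_j le_i => M ge_j le_i.
  rewrite -PoszM -!PoszD; apply: isomorphic_vertex_interval_shift; [lia..|].
  by move=> p q leq lep; apply: riordan_edge_shift aP a_zeros _ _; lia.
pose d := (M.+1 * 2 ^ s)%N.
have Ed : Negz M * (2 ^ s)%N%:Z = - d%:Z by rewrite NegzE mulNr -PoszM.
rewrite Ed in ge_j le_i *.
apply: isomorphic_sym.
have -> : j%:Z - d%:Z = (j - d)%N%:Z by lia.
have -> : i%:Z - d%:Z = (i - d)%N%:Z by lia.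
have := @isomorphic_vertex_interval_shift n (j - d)%N (i - d)%N d g f.
rewrite !subnK; [apply; [lia..|] | lia..].
by move=> p q leq lep; apply: riordan_edge_shift aP a_zeros _ _; lia.
Qed.
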